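(* Let $(M,g)$ be a semi-Riemannian manifold of dimension $n\ge3$ satisfying $P\cdot P=L\,Q(S,P)$ for some $L\in C^\infty(M)$. Then: (i) $P\cdot R=L\,Q(S,R)$ if and only if $R\cdot(\wedge_S)=\left(L+\frac{1}{n-1}\right)Q(S,\wedge_S)$. (ii) $R\cdot R=L\,Q(S,R)$ if and only if $R\cdot(\wedge_S)+Q(S,R)=\left(L+\frac{1}{n-1}\right)Q(S,\wedge_S)$. (iii) $R\cdot P=L\,Q(S,P)$ if and only if $Q(S,P)=0$. (iv) $n(n-1)\,R\cdot S=\kappa\,(1+(n-1)L)\,Q(g,S)$. (v) $(n-1)E=\kappa S-S^2$. (vi) $n^2S^2-2n\kappa S+\kappa^2g=0$ and $\kappa^{(2)}=\frac{\kappa^2}{n}$ if $L\ne-\frac{1}{n-1}$. Moreover, if $M$ is a Riemannian manifold and $L\neq-\frac{1}{n-1}$, then it is an Einstein manifold. (vii) $L\,\kappa\,(nS-\kappa g)=0$.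
   Context: $(M,g)$ is a connected smooth semi-Riemannian manifold of dimension $n\ge 3$; $R$ is the $(0,4)$ Riemann curvature tensor, with the sign convention that the Ricci tensor $S(X_2,X_3)$ is the $g$-trace of $R(X_1,X_2,X_3,X_4)$ over $X_1,X_4$; $\kappa$ is the scalar curvature; $\mathcal S$ is the Ricci operator, $g(\mathcal SX,Y)=S(X,Y)$, $S^2(X,Y)=g(\mathcal S^2X,Y)$, $\kappa^{(2)}=\mathrm{trace}(\mathcal S^2)$. $E(X,Y)$ is the $(0,2)$-tensor obtained by contracting $R(X_1,X,Y,\mathcal SX_2)$ over $X_1,X_2$. Einstein means $S=\frac{\kappa}{n}g$. Projective curvature tensor: $P(X_1,X_2,X_3,X_4)=R(X_1,X_2,X_3,X_4)-\frac{1}{n-1}\left[S(X_2,X_3)g(X_1,X_4)-S(X_1,X_3)g(X_2,X_4)\right]$. For a $(0,4)$-tensor $D$, let $\mathcal D$ be the $(1,3)$-tensor with $g(\mathcal D(X,Y)X_1,X_2)=D(X,Y,X_1,X_2)$. For a $(0,k)$-tensor $H$, $(D\cdot H)(X_1,\dots,X_k,X,Y)=-\sum_{i=1}^kH(X_1,\dots,\mathcal D(X,Y)X_i,\dots,X_k)$. For a symmetric $(0,2)$-tensor $A$, $(X\wedge_AY)Z=A(Y,Z)X-A(X,Z)Y$ and $Q(A,H)(X_1,\dots,X_k,X,Y)=-\sum_{i=1}^k H(X_1,\dots,(X\wedge_AY)X_i,\dots,X_k)$. $\wedge_S$ denotes the $(0,4)$-tensor $\wedge_S(X_1,X_2,X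_3,X_4)=S(X_2,X_3)g(X_1,X_4)-S(X_1,X_3)g(X_2,X_4)$.
   Formalization: Items (v) and (vii) are stated and proved only at points where L ≠ −1/(n−1), the proviso of (vi), read pointwise; as printed they fail for S²×R with n = 3, L = −1/2. *)

(* Defs.v *)
From HB Require Import structures.
From mathcomp Require Import all_boot all_order all_algebra.
From mathcomp Require Import all_classical all_reals.
From mathcomp Require Import topology normedtype derive.

Set Implicit Arguments.
Unset Strict Implicit.
Unset Printing Implicit Defensive.

Import Order.TTheory GRing.Theory Num.Theory.
Import numFieldNormedType.Exports.

Local Open Scope classical_set_scope.
Local Open Scope ring_scope.

Section Calculus.
Context {R : realType} {n : nat}.

Definition pd (i : 'I_n) (f : 'rV[R]_n -> R) : 'rV[R]_n -> R :=
  fun x => 'D_(delta_mx 0 i) f x.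

(* Meant for open U: all iterated partial derivatives exist and are continuous
   at the points of U. *)
Definition smooth_on (U : set 'rV[R]_n) (f : 'rV[R]_n -> R) : Prop :=
  forall (s : seq 'I_n) (x : 'rV[R]_n), U x ->
    {for x, continuous (foldr pd f s)} /\
    forall i : 'I_n, derivable (foldr pd f s) x (delta_mx 0 i).

End Calculus.

(* [coord] and [param] are only meaningful on [cdom] and [coord @` cdom]. *)
Record chart (R : realType) (n : nat) (M : topologicalType) := Chart {
  cdom : set M;
  coord : M -> 'rV[R]_n;
  param : 'rV[R]_n -> M;
  cdom_open : open cdom;
  cim_open : open (coord @` cdom);
  coordK : forall p, cdom p -> param (coord p) = p;
  coord_cont : {within cdom, continuous coord};
  param_cont : {within coord @` cdom, continuous param}
}.

Definition cim (R : realType) (n : nat) (M : topologicalType)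
  (c : chart R n M) : set 'rV[R]_n := coord c @` cdom c.

(* The k-th coordinate of the transition map from chart c to chart d. *)
Definition transition (R : realType) (n : nat) (M : topologicalType)
    (c d : chart R n M) (k : 'I_n) : 'rV[R]_n -> R :=
  fun x => coord d (param c x) 0 k.

Record manifold (R : realType) (n : nat) := Manifold {
  carrier :> topologicalType;
  atlas : set (chart R n carrier);
  manifold_hausdorff : hausdorff_space carrier;
  manifold_second_countable : @second_countable carrier;
  atlas_cover : forall p : carrier, exists2 c, atlas c & cdom c p;
  atlas_compat : forall c d, atlas c -> atlas d ->
    forall k, smooth_on (coord c @` (cdom c `&` cdom d)) (transition c d k)
}.

Arguments atlas {R n} m.

Definition smooth_fun (R : realType) (n : nat) (M : manifold R n)
    (f : M -> R) : Prop :=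
  forall c, atlas M c -> smooth_on (cim c) (f \o param c).

(* [gmat c x] is the matrix of the metric at the point of coordinates x in the
   coordinate frame of the chart c; vectors are rows, so that
   g(v, w) = v *m gmat c x *m w^T. The last field is the transformation law of
   (0,2)-tensors, J being the matrix of partial derivatives of the transition
   map. *)
Record metric (R : realType) (n : nat) (M : manifold R n) := Metric {
  gmat : chart R n M -> 'rV[R]_n -> 'M[R]_n;
  gmat_smooth : forall c, atlas M c ->
    forall i j, smooth_on (cim c) (fun x => gmat c x i j);
  gmat_sym : forall c, atlas M c -> forall x, cim c x ->
    (gmat c x)^T = gmat c x;
  gmat_nondeg : forall c, atlas M c -> forall x, cim c x ->
    gmat c x \in unitmx;
  gmat_change : forall c d, atlas M c -> atlas M d ->
    forall p, cdom c p -> cdom d p ->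
    let J := \matrix_(i, k) pd i (transition c d k) (coord c p) in
    gmat c (coord c p) = J *m gmat d (coord d p) *m J^T
}.

Definition riemannian (R : realType) (n : nat) (M : manifold R n)
    (g : metric M) : Prop :=
  forall c, atlas M c -> forall x, cim c x ->
  forall v : 'rV[R]_n, v != 0 -> 0 < (v *m gmat g c x *m v^T) 0 0.

Definition gprod (R : realType) (n : nat) (G : 'M[R]_n)
  (v w : 'rV[R]_n) : R := (v *m G *m w^T) 0 0.

Section Curvature.
Context {R : realType} {n : nat} (G : 'rV[R]_n -> 'M[R]_n).

(* Gamma^k_ij *)
Definition christoffel (i j k : 'I_n) (x : 'rV[R]_n) : R :=
  2^-1 * \sum_l invmx (G x) k l *
    (pd i (fun y => G y j l) x + pd j (fun y => G y i l) x
     - pd l (fun y => G y i j) x).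

(* The coefficient on d_l of
   R(d_i, d_j) d_k = nabla_i nabla_j d_k - nabla_j nabla_i d_k. *)
Definition curv_coef (i j k l : 'I_n) (x : 'rV[R]_n) : R :=
  pd i (christoffel j k l) x - pd j (christoffel i k l) x
  + \sum_m (christoffel i m l x * christoffel j k m x
            - christoffel j m l x * christoffel i k m x).

Definition curv_op (x u v w : 'rV[R]_n) : 'rV[R]_n :=
  \row_l \sum_i \sum_j \sum_k u 0 i * v 0 j * w 0 k * curv_coef i j k l x.

Definition riemann (x u v w z : 'rV[R]_n) : R :=
  gprod (G x) (curv_op x u v w) z.

End Curvature.

(* The tangent space is identified with 'rV[R]_n by a coordinate frame. *)
Notation tensor R n k := (k.-tuple 'rV[R]_n -> R).

Section Tensors.
Context {R : realType} {n : nat}.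
Local Notation V := 'rV[R]_n.
Implicit Types (G : 'M[R]_n) (k : nat).

Definition tensor2 (F : V -> V -> R) : tensor R n 2 :=
  fun X => F (tnth X 0) (tnth X 1).

Definition tensor4 (F : V -> V -> V -> V -> R) : tensor R n 4 :=
  fun X => F (tnth X 0) (tnth X 1) (tnth X 2) (tnth X 3).

(* The g-trace of a bilinear form. *)
Definition gtrace G (B : V -> V -> R) : R :=
  \sum_i \sum_j invmx G i j * B (delta_mx 0 i) (delta_mx 0 j).

(* For f linear, the vector v such that g(v, w) = f w for all w. *)
Definition sharp G (f : V -> R) : V := (\row_j f (delta_mx 0 j)) *m invmx G.

(* The derivation-like action of a (1,3)-tensor T, the two new arguments
   coming last:
   (X_1, ..., X_k, X, Y) |-> - \sum_i H(X_1, ..., T(X, Y) X_i, ..., X_k). *)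
Definition action k (T : V -> V -> V -> V) (H : tensor R n k) :
    tensor R n (k + 2) := fun X =>
  let x := tnth X (rshift k 0) in
  let y := tnth X (rshift k 1) in
  - \sum_(i < k) H [tuple if j == i then T x y (tnth X (lshift 2 j))
                          else tnth X (lshift 2 j) | j < k].

(* D . H *)
Definition dot G k (D : tensor R n 4) (H : tensor R n k) : tensor R n (k + 2) :=
  action (fun x y z => sharp G (fun w => D [tuple x; y; z; w])) H.

Definition wedge (A : tensor R n 2) (x y z : V) : V :=
  A [tuple y; z] *: x - A [tuple x; z] *: y.

(* Q(A, H) *)
Definition tachibana k (A : tensor R n 2) (H : tensor R n k) :
  tensor R n (k + 2) := action (wedge A) H.

End Tensors.

(* The metric and its (0,4) Riemann tensor at one point, in a frame. *)
Record geom (R : realType) (n : nat) := Geom {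
  gm : 'M[R]_n;
  rm : 'rV[R]_n -> 'rV[R]_n -> 'rV[R]_n -> 'rV[R]_n -> R
}.

Section Geom.
Context {R : realType} {n : nat} (a : geom R n).
Local Notation V := 'rV[R]_n.

Definition ric (y z : V) : R := gtrace (gm a) (fun x w => rm a x y z w).

Definition ric_op (x : V) : V := sharp (gm a) (ric x).

Definition scal : R := gtrace (gm a) ric.

Definition scal2 : R := \tr (lin1_mx (ric_op \o ric_op)).

Definition gT : tensor R n 2 := tensor2 (gprod (gm a)).

Definition RT : tensor R n 4 := tensor4 (rm a).

Definition ST : tensor R n 2 := tensor2 ric.

Definition S2T : tensor R n 2 :=
  tensor2 (fun x y => gprod (gm a) (ric_op (ric_op x)) y).

Definition ET : tensor R n 2 :=
  tensor2 (fun x y => gtrace (gm a) (fun u v => rm a u x y (ric_op v))).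

Definition wedgeST : tensor R n 4 :=
  tensor4 (fun x1 x2 x3 x4 =>
    ric x2 x3 * gprod (gm a) x1 x4 - ric x1 x3 * gprod (gm a) x2 x4).

(* The projective curvature tensor. *)
Definition PT : tensor R n 4 := RT - (n%:R - 1)^-1 *: wedgeST.

End Geom.

Section Identities.
Context {R : realType} {n : nat} {M : manifold R n} (g : metric M).

Definition geom_at (c : chart R n M) (p : M) : geom R n :=
  Geom (gmat g c (coord c p)) (riemann (gmat g c) (coord c p)).

(* Phi holds at every point of U, in the coordinate frame of every chart of the
   atlas around that point. *)
Definition holds_on (U : set M) (Phi : M -> geom R n -> Prop) : Prop :=
  forall c p, atlas M c -> cdom c p -> U p -> Phi p (geom_at c p).

Definition holds (Phi : M -> geom R n -> Prop) : Prop := holds_on setT Phi.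

(* U = M: (M, g) is an Einstein manifold. *)
Definition einstein_on (U : set M) : Prop :=
  holds_on U (fun _ a => ST a = (scal a / n%:R) *: gT a).

End Identities.

(* Main.v *)
(* Everything is pointwise linear algebra once the Riemann tensor is known to
   have its usual symmetries. With c = 1/(n-1) and lam = L + c one has
   P.H = R.H - c Q(S,H), so the hypothesis reads R.P = lam Q(S,P), and (i)-(iii)
   follow by expanding P = R - c wedge_S. Contracting R.P = lam Q(S,P) over the
   pairs (3,4), (1,4) and (2,3) of arguments of P gives, where lam <> 0:
   (3,4): twice the (2x2)-minors of S are the Kulkarni-Nomizu product of g and
          S^2 ([ric_minors]), and a further trace is (vi);
   (1,4): an identity on P ([proj14_contract]) whose trace is (v);
   (2,3): a formula for R.S whose remainder vanishes by the two previous ones,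
          that is (iv); its trace, with (v) and (vi), is (vii).
   For definite g, (vi) says that n A - kappa has null image, so it is 0. *)

Require Import Defs.
From HB Require Import structures.
From mathcomp Require Import all_boot all_order all_algebra.
From mathcomp Require Import all_classical all_reals.
From mathcomp Require Import topology normedtype derive.
From mathcomp Require Import ring lra.

Set Implicit Arguments.
Unset Strict Implicit.
Unset Printing Implicit Defensive.

Import Order.TTheory GRing.Theory Num.Theory.
Import numFieldNormedType.Exports.

Local Open Scope classical_set_scope.
Local Open Scope ring_scope.

(** * Traces with respect to a metric *)

Section MetricTrace.
Context {R : realType} {n : nat} (G : 'M[R]_n).
Local Notation V := 'rV[R]_n.
Local Notation tr := (gtrace G).
Local Notation "'g" := (gprod G).

Lemma scalar_eq0 (f : V -> R) : scalar f -> f 0 = 0.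
Proof.
by move=> fl; have := fl (-1) 0 0; rewrite scaler0 addr0 mulN1r addNr.
Qed.

Lemma scalar_sum_delta (f : V -> R) : scalar f ->
  forall w, f w = \sum_i w 0 i * f (delta_mx 0 i).
Proof.
move=> fl w.
have f0 := scalar_eq0 fl.
have fD u v : f (u + v) = f u + f v by have := fl 1 u v; rewrite scale1r mul1r.
rewrite {1}(row_sum_delta w) (big_morph f fD f0).
apply: eq_bigr => i _; have := fl (w 0 i) (delta_mx 0 i) 0.
by rewrite f0 !addr0.
Qed.

Lemma scalar_lincombB (f : V -> R) : scalar f ->
  forall a b u v, f (a *: u - b *: v) = a * f u - b * f v.
Proof.
move=> fl a b u v; rewrite fl -scaleNr -[- b *: v]addr0 fl.
by rewrite (scalar_eq0 fl) addr0 mulNr.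
Qed.

Lemma eq_gtrace (A B : V -> V -> R) : (forall u v, A u v = B u v) ->
  tr (fun u v => A u v) = tr (fun u v => B u v).
Proof.
by move=> AB; apply: eq_bigr => i _; apply: eq_bigr => j _; rewrite AB.
Qed.

Lemma gtraceD (A B : V -> V -> R) :
  tr (fun u v => A u v + B u v) = tr (fun u v => A u v) + tr (fun u v => B u v).
Proof.
rewrite /gtrace -big_split; apply: eq_bigr => i _; rewrite -big_split.
by apply: eq_bigr => j _; rewrite /= mulrDr.
Qed.

Lemma gtraceZ a (B : V -> V -> R) :
  tr (fun u v => a * B u v) = a * tr (fun u v => B u v).
Proof.
rewrite /gtrace mulr_sumr; apply: eq_bigr => i _; rewrite mulr_sumr.
by apply: eq_bigr => j _; rewrite mulrCA.
Qed.

Lemma gtraceZr (B : V -> V -> R) a :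
  tr (fun u v => B u v * a) = tr (fun u v => B u v) * a.
Proof. by rewrite mulrC -gtraceZ; apply: eq_gtrace => u v; rewrite mulrC. Qed.

Lemma gtrace0 : tr (fun _ _ => 0) = 0.
Proof. by apply: big1 => i _; apply: big1 => j _; rewrite mulr0. Qed.

Lemma gtraceN (B : V -> V -> R) :
  tr (fun u v => - B u v) = - tr (fun u v => B u v).
Proof.
by rewrite -mulN1r -gtraceZ; apply: eq_gtrace => u v; rewrite mulN1r.
Qed.

Lemma gtraceB (A B : V -> V -> R) :
  tr (fun u v => A u v - B u v) = tr (fun u v => A u v) - tr (fun u v => B u v).
Proof. by rewrite gtraceD gtraceN. Qed.

Lemma gprod_scalarl v : scalar ('g^~ v).
Proof. by move=> a u w; rewrite /gprod !mulmxDl -!scalemxAl !mxE. Qed.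

Lemma gprod_scalarr u : scalar ('g u).
Proof. by move=> a v w; rewrite /gprod linearP mulmxDr -scalemxAr !mxE. Qed.

Hypotheses (Gsym : G^T = G) (Gunit : G \in unitmx).

Lemma gprodC u v : 'g u v = 'g v u.
Proof.
by rewrite /gprod -[LHS]trace_mx11 -mxtrace_tr !trmx_mul trmxK Gsym mulmxA
  trace_mx11.
Qed.

Lemma gprod_inj u v : (forall w, 'g u w = 'g v w) -> u = v.
Proof.
move=> uv; suff: u *m G = v *m G by move/(can_inj (mulmxK Gunit)).
apply/rowP => j; have := uv (delta_mx 0 j).
by rewrite /gprod trmx_delta -!colE !mxE.
Qed.

Lemma sharpP f : scalar f -> forall w, 'g (sharp G f) w = f w.
Proof.
move=> fl w; rewrite /gprod /sharp mulmxKV // mxE (scalar_sum_delta fl w).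
by apply: eq_bigr => j _; rewrite !mxE mulrC.
Qed.

Lemma invmx_symE i j : invmx G i j = invmx G j i.
Proof. by rewrite -{1}Gsym -trmx_inv mxE. Qed.

Lemma gtraceC (B : V -> V -> R) : tr (fun u v => B u v) = tr (fun u v => B v u).
Proof.
rewrite /gtrace exchange_big; apply: eq_bigr => j _; apply: eq_bigr => i _.
by rewrite invmx_symE.
Qed.

(** Contracting with [invmx G] undoes the lowering by [G]: the coefficients of ['g w] form the row
    [w *m G], and [w *m G *m invmx G = w]. *)
Lemma gtrace_dual f w : scalar f -> tr (fun u v => 'g w u * f v) = f w.
Proof.
move=> fl; rewrite /gtrace exchange_big (scalar_sum_delta fl w).
apply: eq_bigr => j _.
under eq_bigr => i _ do rewrite mulrA.
rewrite -mulr_suml; congr (_ * _).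
have /(congr1 (fun M : 'rV_n => M 0 j)) : w *m G *m invmx G = w.
  by rewrite mulmxK.
rewrite mxE => <-; apply: eq_bigr => i _; rewrite mulrC; congr (_ * _).
by rewrite /gprod trmx_delta -colE mxE.
Qed.

Lemma gtrace_dualC f w : scalar f -> tr (fun u v => 'g w v * f u) = f w.
Proof. by move=> fl; rewrite gtraceC gtrace_dual. Qed.

Lemma exchange_gtrace (F : V -> V -> V -> V -> R) :
  tr (fun u v => tr (fun p q => F u v p q)) =
  tr (fun p q => tr (fun u v => F u v p q)).
Proof.
rewrite /gtrace.
under eq_bigr => i _ do under eq_bigr => j _ do
  (rewrite mulr_sumr; under eq_bigr => k _ do rewrite mulr_sumr).
under eq_bigr => i _ do rewrite exchange_big.
rewrite exchange_big; apply: eq_bigr => k _.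
under eq_bigr => i _ do rewrite exchange_big.
rewrite exchange_big; apply: eq_bigr => l _.
rewrite mulr_sumr; apply: eq_bigr => i _; rewrite mulr_sumr.
by apply: eq_bigr => j _; rewrite mulrCA.
Qed.

(** By [gtrace_dual], [B (A u) v] is the trace over p, q of g(Au, p) B(q, v). In this form [A] can
    be moved across the metric onto p; exchanging the two traces and contracting u, v then evaluates
    the second slot of [B] at [A' p]. *)
Lemma gtrace_adjoint (B : V -> V -> R) (A A' : V -> V) :
  (forall v, scalar (B^~ v)) -> (forall u, scalar (B u)) ->
  (forall u v, 'g (A u) v = 'g u (A' v)) ->
  tr (fun u v => B (A u) v) = tr (fun u v => B u (A' v)).
Proof.
move=> Bl Br AA'.
have -> : tr (fun u v => B (A u) v) =
    tr (fun u v => tr (fun p q => 'g (A' p) u * B q v)).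
  apply: eq_gtrace => u v; rewrite -(gtrace_dual (A u) (Bl v)).
  by apply: eq_gtrace => p q; rewrite AA' gprodC.
rewrite exchange_gtrace [RHS]gtraceC; apply: eq_gtrace => p q.
exact: gtrace_dual.
Qed.

Lemma gtrace_selfadjoint (B : V -> V -> R) (A : V -> V) :
  (forall v, scalar (B^~ v)) -> (forall u, scalar (B u)) ->
  (forall u v, 'g (A u) v = 'g u (A v)) ->
  tr (fun u v => B (A u) v) = tr (fun u v => B u (A v)).
Proof. exact: gtrace_adjoint. Qed.

(** This is [gtrace_adjoint] with adjoint [- A]. It expresses that the metric trace is invariant
    under skew endomorphisms, and so commutes with the action of R(x, y). *)
Lemma gtrace_skew (B : V -> V -> R) (A : V -> V) :
  (forall v, scalar (B^~ v)) -> (forall u, scalar (B u)) ->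
  (forall u v, 'g (A u) v = - 'g (A v) u) ->
  tr (fun u v => B (A u) v) + tr (fun u v => B u (A v)) = 0.
Proof.
move=> Bl Br sA; have BN u v : B u (- v) = - B u v.
  by have := scalar_lincombB (Br u) 0 1 0 v;
    rewrite scaler0 sub0r scale1r mul0r mul1r sub0r.
rewrite (gtrace_adjoint Bl Br (A' := fun v => - A v)) => [|u v].
  by under eq_gtrace do rewrite BN; rewrite gtraceN addNr.
have := scalar_lincombB (gprod_scalarr u) 0 1 0 (A v).
by rewrite scaler0 sub0r scale1r mul0r mul1r sub0r sA => ->; rewrite gprodC.
Qed.

(** Row by row, [invmx G] cancels the [G] of the product. Through this, kappa^(2), defined as a
    matrix trace, becomes the metric trace of S^2 in [gtrace_ric2]. *)
Lemma gtrace_gprod_lin (A : V -> V) : tr (fun u v => 'g (A u) v) = \tr (lin1_mx A).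
Proof.
rewrite /gtrace /mxtrace; apply: eq_bigr => i _; rewrite mxE.
have /(congr1 (fun M : 'rV_n => M 0 i)) :
    A (delta_mx 0 i) *m G *m invmx G = A (delta_mx 0 i) by rewrite mulmxK.
rewrite [LHS]mxE => <-; apply: eq_bigr => j _.
by rewrite invmx_symE mulrC /gprod trmx_delta -colE [in LHS]mxE.
Qed.

Lemma gtrace_gprod : tr (fun u v => 'g u v) = n%:R.
Proof.
rewrite (gtrace_gprod_lin id) -[RHS](@mxtrace_scalar R n 1); congr (\tr _).
by apply/matrixP => i j; rewrite !mxE eqxx eq_sym.
Qed.

End MetricTrace.

(** * Algebraic curvature tensors *)

Section CurvatureLike.
Context {R : realType} {n : nat}.
Local Notation V := 'rV[R]_n.

Record multilinear4 (F : V -> V -> V -> V -> R) : Prop := Multilinear4 {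
  mlin1 : forall y z w, scalar (fun x => F x y z w);
  mlin2 : forall x z w, scalar (fun y => F x y z w);
  mlin3 : forall x y w, scalar (fun z => F x y z w);
  mlin4 : forall x y z, scalar (F x y z)
}.

(** The properties of the metric and its Riemann tensor at one point on which the algebra below
    rests; [riemann_curvature_like] establishes them for a smooth metric. *)
Record curvature_like (a : geom R n) : Prop := CurvatureLike {
  gm_sym : (gm a)^T = gm a;
  gm_unit : gm a \in unitmx;
  rm_mlin : multilinear4 (rm a);
  rm_skew12 : forall x y z w, rm a x y z w = - rm a y x z w;
  rm_skew34 : forall x y z w, rm a x y z w = - rm a x y w z;
  rm_bianchi : forall x y z w,
    rm a x y z w + rm a y z x w + rm a z x y w = 0
}.

Lemma tensor_ext6 (F F' : tensor R n 6) :
  (forall x1 x2 x3 x4 x y, F [tuple x1; x2; x3; x4; x; y]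
                         = F' [tuple x1; x2; x3; x4; x; y]) -> F = F'.
Proof.
move=> FF'; apply/funext => -[[|a[|b[|c[|d[|e[|f[|? ?]]]]]]] //= sz].
by have := FF' a b c d e f; congr (F _ = F' _); exact: val_inj.
Qed.

Lemma tensor_ext4 (F F' : tensor R n 4) :
  (forall x1 x2 x y, F [tuple x1; x2; x; y] = F' [tuple x1; x2; x; y]) -> F = F'.
Proof.
move=> FF'; apply/funext => -[[|a[|b[|c[|d[|? ?]]]]] //= sz].
by have := FF' a b c d; congr (F _ = F' _); exact: val_inj.
Qed.

Lemma tensor_ext2 (F F' : tensor R n 2) :
  (forall x y, F [tuple x; y] = F' [tuple x; y]) -> F = F'.
Proof.
move=> FF'; apply/funext => -[[|a[|b[|? ?]]] //= sz].
by have := FF' a b; congr (F _ = F' _); exact: val_inj.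
Qed.

Lemma action_tensor4E (T : V -> V -> V -> V) F x1 x2 x3 x4 x y :
  action T (tensor4 F) [tuple x1; x2; x3; x4; x; y] =
  - (F (T x y x1) x2 x3 x4 + F x1 (T x y x2) x3 x4
     + F x1 x2 (T x y x3) x4 + F x1 x2 x3 (T x y x4)).
Proof.
rewrite /action !big_ord_recl big_ord0 addr0 /tensor4 !tnth_mktuple !addrA.
by [].
Qed.

Lemma action_tensor2E (T : V -> V -> V -> V) F x1 x2 x y :
  action T (tensor2 F) [tuple x1; x2; x; y] =
  - (F (T x y x1) x2 + F x1 (T x y x2)).
Proof.
by rewrite /action !big_ord_recl big_ord0 addr0 /tensor2 !tnth_mktuple.
Qed.

Lemma tensorBZE k (H K : tensor R n k) c X : (H - c *: K) X = H X - c * K X.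
Proof. by []. Qed.

Lemma tensorZE k (H : tensor R n k) c X : (c *: H) X = c * H X.
Proof. by []. Qed.

Lemma actionB k (T : V -> V -> V -> V) (H K : tensor R n k) c :
  action T (H - c *: K) = action T H - c *: action T K.
Proof.
apply/funext => X; rewrite tensorBZE /action -!sumrN mulr_sumr -sumrB.
by apply: eq_bigr => i _; rewrite mulrN -opprD.
Qed.

End CurvatureLike.

(** * Ricci tensor, Ricci operator and contraction of a curvature condition *)

Section RicciAlgebra.
Context {R : realType} {n : nat} (a : geom R n) (ca : curvature_like a).
Local Notation V := 'rV[R]_n.
Local Notation tr := (gtrace (gm a)).
Local Notation "'g" := (gprod (gm a)).
Local Notation r := (rm a).
Local Notation S := (ric a).
Local Notation A := (ric_op a).

Let Gsym := gm_sym ca.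
Let Gunit := gm_unit ca.
Let gC := gprodC Gsym.
Let r3 := mlin3 (rm_mlin ca).
Let r4 := mlin4 (rm_mlin ca).

Lemma rm_pair_sym x y z w : r x y z w = r z w x y.
Proof.
have b := rm_bianchi ca; have s := rm_skew12 ca; have t := rm_skew34 ca.
(* The classical argument: the Bianchi identities for the four cyclic shifts of (x, y, z, w),
   brought to common terms by the two skew symmetries, combine linearly to the pair symmetry. *)
have := b x y z w; have := b y z w x; have := b z w x y; have := b w x y z.
rewrite (t y z w x) (t z w y x) (t w x y z) (t x y w z).
rewrite (s x z w y) (t z x w y) (s y w x z) (t w y x z).
by lra.
Qed.

Lemma ric_sym y z : S y z = S z y.
Proof.
rewrite /ric (gtraceC Gsym); apply: eq_gtrace => x w.
by rewrite rm_pair_sym (rm_skew12 ca) (rm_skew34 ca) opprK.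
Qed.

Lemma ric_scalarr y : scalar (S y).
Proof.
move=> c u v; rewrite /ric -gtraceZ -gtraceD; apply: eq_gtrace => x w.
exact: r3.
Qed.

Lemma ric_scalarl z : scalar (S^~ z).
Proof. by move=> c u v; rewrite ![S _ z]ric_sym ric_scalarr. Qed.

Lemma ric_opP x y : 'g (A x) y = S x y.
Proof. exact: sharpP (ric_scalarr x) y. Qed.

Lemma ric_op_selfadjoint x y : 'g (A x) y = 'g x (A y).
Proof. by rewrite [RHS]gC !ric_opP ric_sym. Qed.

(** S(w, .) is the metric dual of [A w], so this is [gtrace_dual] at [A w]. It is how the Ricci
    operator arises from contracting Q(S, .). *)
Lemma gtrace_ric_dual f w : scalar f -> tr (fun u v => S w u * f v) = f (A w).
Proof.
move=> fl; rewrite -(gtrace_dual Gunit (A w) fl).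
by apply: eq_gtrace => u v; rewrite ric_opP.
Qed.

Lemma gtrace_ric_dualC f w : scalar f -> tr (fun u v => S w v * f u) = f (A w).
Proof. by move=> fl; rewrite (gtraceC Gsym) gtrace_ric_dual. Qed.

Lemma gtrace_ric : tr (fun u v => S u v) = scal a.
Proof. by []. Qed.

Lemma gtrace_ric2 : tr (fun u v => S (A u) v) = scal2 a.
Proof.
rewrite /scal2 -(gtrace_gprod_lin Gsym Gunit (A \o A)).
by apply: eq_gtrace => u v; rewrite /= ric_opP.
Qed.

Lemma ric2_sym x y : S (A x) y = S (A y) x.
Proof. by rewrite ric_sym -ric_opP -ric_op_selfadjoint ric_opP. Qed.

Lemma ric2_scalarl y : scalar (fun x => S (A x) y).
Proof. by move=> b u v; rewrite ![S (A _) y]ric2_sym ric_scalarr. Qed.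

Lemma gtrace_rm_ric x y : tr (fun u v => r u x y (A v)) = ET a [tuple x; y].
Proof. by []. Qed.

(** The endomorphism R(x, y), written in the shape used by [dot], so that [dot_RT] holds by
    conversion. *)
Definition curv_endo (x y z : V) : V := sharp (gm a) (r x y z).

Lemma curv_endoP x y z w : 'g (curv_endo x y z) w = r x y z w.
Proof. exact: sharpP (r4 x y z) w. Qed.

Lemma curv_endo_skew x y u v :
  'g (curv_endo x y u) v = - 'g (curv_endo x y v) u.
Proof. by rewrite !curv_endoP (rm_skew34 ca). Qed.

(** The derivation action of one endomorphism, without the minus sign of [action]; in equations
    between two such actions the signs cancel. *)
Definition deriv4 (T : V -> V) (F : V -> V -> V -> V -> R) x1 x2 x3 x4 : R :=
  F (T x1) x2 x3 x4 + F x1 (T x2) x3 x4 + F x1 x2 (T x3) x4 + F x1 x2 x3 (T x4).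

(** Trace the hypothesis over x3, x4. On the left the terms acting in slots 3 and 4 cancel by
    [gtrace_skew], since R(x, y) is skew for g. On the right the factors S(y, x3), S(x, x3), S(y,
    x4), S(x, x4) turn into [A y] and [A x] inside F. F is arbitrary, so permuting the arguments of
    P gives its contractions over other pairs of slots. *)
Lemma contract34 F lam x1 x2 x y (t := fun x1 x2 => tr (fun u v => F x1 x2 u v)) :
  multilinear4 F ->
  (forall x3 x4, deriv4 (curv_endo x y) F x1 x2 x3 x4
     = lam * deriv4 (wedge (ST a) x y) F x1 x2 x3 x4) ->
  t (curv_endo x y x1) x2 + t x1 (curv_endo x y x2)
  = lam * (S y x1 * t x x2 - S x x1 * t y x2
           + (S y x2 * t x1 x - S x x2 * t x1 y)
           + (F x1 x2 x (A y) - F x1 x2 y (A x))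
           + (F x1 x2 (A y) x - F x1 x2 (A x) y)).
Proof.
move=> [F1 F2 F3 F4] H.
have {H}H x3 x4 : F (curv_endo x y x1) x2 x3 x4 + F x1 (curv_endo x y x2) x3 x4
     + (F x1 x2 (curv_endo x y x3) x4 + F x1 x2 x3 (curv_endo x y x4))
     = lam * (S y x1 * F x x2 x3 x4 - S x x1 * F y x2 x3 x4
     + (S y x2 * F x1 x x3 x4 - S x x2 * F x1 y x3 x4)
     + (S y x3 * F x1 x2 x x4 - S x x3 * F x1 x2 y x4)
     + (S y x4 * F x1 x2 x3 x - S x x4 * F x1 x2 x3 y)).
  rewrite addrA [LHS]H /deriv4 /wedge.
  rewrite (scalar_lincombB (F1 _ _ _)) (scalar_lincombB (F2 _ _ _)).
  by rewrite (scalar_lincombB (F3 _ _ _)) (scalar_lincombB (F4 _ _ _)).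
have := eq_gtrace (gm a) H.
rewrite gtraceZ !(gtraceD, gtraceN, gtraceZ).
rewrite (gtrace_skew Gsym Gunit _ _ (curv_endo_skew x y)) // addr0.
by rewrite !gtrace_ric_dual // !gtrace_ric_dualC.
Qed.

End RicciAlgebra.

(** * Contractions of the projective curvature condition *)

Section Projective.
Context {R : realType} {n : nat} (a : geom R n) (ca : curvature_like a).
Hypothesis n_ge3 : (3 <= n)%N.
Local Notation V := 'rV[R]_n.
Local Notation tr := (gtrace (gm a)).
Local Notation "'g" := (gprod (gm a)).
Local Notation r := (rm a).
Local Notation S := (ric a).
Local Notation A := (ric_op a).
Local Notation c := ((n%:R - 1)^-1 : R).
Local Notation K := (curv_endo a).

Let Gsym := gm_sym ca.
Let Gunit := gm_unit ca.
Let gC := gprodC Gsym.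
Let gl := @gprod_scalarl R n (gm a).
Let gr := @gprod_scalarr R n (gm a).
Let r1 := mlin1 (rm_mlin ca).
Let r2 := mlin2 (rm_mlin ca).
Let r3 := mlin3 (rm_mlin ca).
Let r4 := mlin4 (rm_mlin ca).
Let Sl := ric_scalarl ca.
Let Sr := ric_scalarr ca.

Lemma natrB1_neq0 : n%:R - 1 != 0 :> R.
Proof. by rewrite subr_eq0 pnatr_eq1; case: n n_ge3 => [|[]]. Qed.

Lemma dim_neq0 : n%:R != 0 :> R.
Proof. by case: n n_ge3 => // m _; rewrite pnatr_eq0. Qed.

Definition proj4 x1 x2 x3 x4 : R :=
  r x1 x2 x3 x4 - c * (S x2 x3 * 'g x1 x4 - S x1 x3 * 'g x2 x4).

Lemma PT_E : PT a = tensor4 proj4. Proof. by []. Qed.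

Lemma wedge_multilinear :
  multilinear4 (fun x1 x2 x3 x4 => S x2 x3 * 'g x1 x4 - S x1 x3 * 'g x2 x4).
Proof. by split=> x y z b u v; rewrite ?(gl, gr, Sl, Sr); ring. Qed.

Lemma proj4_multilinear : multilinear4 proj4.
Proof.
have [w1 w2 w3 w4] := wedge_multilinear.
by split=> x y z b u v; rewrite /proj4 (r1, r2, r3, r4) (w1, w2, w3, w4); ring.
Qed.

Lemma dot_RT k (T : tensor R n k) : dot (gm a) (RT a) T = action K T.
Proof. by []. Qed.

(** Raising the last index of [wedgeST] gives the endomorphism [wedge (ST a) x y], so the
    endomorphism of P is that of R minus c times this one, and the action on a multilinear F is
    linear in the endomorphism. *)
Lemma dot_PT F : multilinear4 F ->
  dot (gm a) (PT a) (tensor4 F)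
  = dot (gm a) (RT a) (tensor4 F) - c *: tachibana (ST a) (tensor4 F).
Proof.
move=> [F1 F2 F3 F4]; apply: tensor_ext6 => x1 x2 x3 x4 x y.
rewrite dot_RT /dot PT_E.
have E z : sharp (gm a) (fun w => tensor4 proj4 [tuple x; y; z; w]) =
    1 *: K x y z - c *: wedge (ST a) x y z.
  apply: (gprod_inj Gunit) => w.
  rewrite (sharpP Gunit (mlin4 proj4_multilinear x y z)).
  rewrite (scalar_lincombB (gl w)) (curv_endoP ca) /wedge.
  by rewrite (scalar_lincombB (gl w)) mul1r.
rewrite tensorBZE /tachibana !action_tensor4E !E.
rewrite (scalar_lincombB (F1 _ _ _)) (scalar_lincombB (F2 _ _ _)).
rewrite (scalar_lincombB (F3 _ _ _)) (scalar_lincombB (F4 _ _ _)).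
by ring.
Qed.


Let nz := natrB1_neq0.

(** R is skew in its last two arguments, and the two terms of wedge_S have equal traces because S is
    symmetric. *)
Lemma gtrace_proj34 x1 x2 : tr (fun u v => proj4 x1 x2 u v) = 0.
Proof.
rewrite /proj4 gtraceB gtraceZ gtraceB.
under [X in c * (X - _)]eq_gtrace do rewrite gC.
under [X in c * (_ - X)]eq_gtrace do rewrite gC.
have -> : tr (fun u v => r x1 x2 u v) = 0.
  have : tr (fun u v => r x1 x2 u v) = - tr (fun u v => r x1 x2 u v).
    rewrite {1}(gtraceC Gsym) -gtraceN; apply: eq_gtrace => u v.
    exact: rm_skew34.
  by lra.
have -> : tr (fun u v => S x2 u * 'g v x1) = S x2 x1.
  rewrite -(gtrace_dualC Gsym Gunit x1 (Sr x2)).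
  by apply: eq_gtrace => u v; rewrite mulrC gC.
have -> : tr (fun u v => S x1 u * 'g v x2) = S x2 x1.
  rewrite (ric_sym ca x2) -(gtrace_dualC Gsym Gunit x2 (Sr x1)).
  by apply: eq_gtrace => u v; rewrite mulrC gC.
by ring.
Qed.

(** The (1,4)-traces of R and wedge_S are S and n S - S, so the coefficient 1/(n-1) is exactly what
    makes P trace-free here. *)
Lemma gtrace_proj14 x2 x3 : tr (fun u v => proj4 u x2 x3 v) = 0.
Proof.
rewrite /proj4 gtraceB gtraceZ gtraceB gtraceZ (gtrace_gprod Gsym Gunit).
have -> : tr (fun u v => r u x2 x3 v) = S x2 x3 by [].
have -> : tr (fun u v => S u x3 * 'g x2 v) = S x2 x3.
  rewrite -(gtrace_dualC Gsym Gunit x2 (Sl x3)).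
  by apply: eq_gtrace => u v; rewrite mulrC.
by field.
Qed.

(** The (2,3)-traces of R and wedge_S are S and kappa g - S. The result measures the failure of the
    Einstein condition. *)
Lemma gtrace_proj23 x1 x4 :
  tr (fun u v => proj4 x1 u v x4) = c * (n%:R * S x1 x4 - scal a * 'g x1 x4).
Proof.
rewrite /proj4 gtraceB gtraceZ gtraceB.
have -> : tr (fun u v => r x1 u v x4) = S x1 x4.
  apply: eq_gtrace => u v.
  by rewrite (rm_skew12 ca) (rm_skew34 ca) opprK.
have -> : tr (fun u v => S u v * 'g x1 x4) = scal a * 'g x1 x4.
  by rewrite mulrC -gtraceZ; apply: eq_gtrace => u v; rewrite mulrC.
have -> : tr (fun u v => S x1 v * 'g u x4) = S x1 x4.
  rewrite -(gtrace_dualC Gsym Gunit x4 (Sr x1)) (gtraceC Gsym).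
  by apply: eq_gtrace => u v; rewrite mulrC gC.
by field.
Qed.

Context (lam : R).
Hypothesis HP : dot (gm a) (RT a) (PT a) = lam *: tachibana (ST a) (PT a).

Lemma curv_proj4 x1 x2 x3 x4 x y :
  deriv4 (K x y) proj4 x1 x2 x3 x4
  = lam * deriv4 (wedge (ST a) x y) proj4 x1 x2 x3 x4.
Proof.
have := congr1 (fun T : tensor R n 6 => T [tuple x1; x2; x3; x4; x; y]) HP.
rewrite dot_RT tensorZE /tachibana PT_E !action_tensor4E mulrN.
exact: oppr_inj.
Qed.

(** The (2,3)-contraction. On the right the products of two values of S cancel by symmetry of S,
    leaving the terms in kappa S g and those where the Ricci operator has entered P. The statement
    covers every value of [lam], including 0. *)
Lemma curv_ric_contract x1 x4 x y :
  n%:R * (S (K x y x1) x4 + S x1 (K x y x4))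
  = lam * (- scal a * (S y x1 * 'g x x4 - S x x1 * 'g y x4
                      + S y x4 * 'g x1 x - S x x4 * 'g x1 y)
      + (n%:R - 1) * (proj4 x1 x (A y) x4 - proj4 x1 y (A x) x4
                      + proj4 x1 (A y) x x4 - proj4 x1 (A x) y x4)).
Proof.
(* R(x, y) is skew for g, so the kappa g half of the (2,3)-trace drops out on the left. *)
have gK : 'g (K x y x1) x4 + 'g x1 (K x y x4) = 0.
  by rewrite [X in _ + X]gC (curv_endo_skew ca) addNr.
have [P1 P2 P3 P4] := proj4_multilinear.
(* Slots 2 and 3 of P become the last two slots of F, as [contract34] requires. *)
pose F y1 y2 y3 y4 := proj4 y1 y3 y4 y2.
have Fml : multilinear4 F.
  by split=> y1 y2 y3 b u v; rewrite /F (P1, P2, P3, P4).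
have HF x2 x3 : deriv4 (K x y) F x1 x4 x2 x3
    = lam * deriv4 (wedge (ST a) x y) F x1 x4 x2 x3.
  transitivity (deriv4 (K x y) proj4 x1 x2 x3 x4).
    by rewrite /deriv4 /F; ring.
  by rewrite curv_proj4 /deriv4 /F; ring.
have /= := contract34 ca Fml HF; rewrite /F !gtrace_proj23.
move: gK; set k1 := S (K x y x1) x4; set k2 := S x1 (K x y x4).
set g1 := 'g _ _; set g2 := 'g _ _ => gK E.
have {E} : (n%:R - 1) * (c * (n%:R * k1 - scal a * g1) + c * (n%:R * k2 - scal a * g2)) = _
  := congr1 ( *%R (n%:R - 1)) E.
have -> : g2 = - g1 by lra.
rewrite (_ : (n%:R - 1) * (_ + _) = n%:R * (k1 + k2)); last by field.
move=> ->; rewrite (ric_sym ca x1 x) (ric_sym ca x1 y); field.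
by [].
Qed.

Hypothesis lam_neq0 : lam != 0.

(** Since the (1,4)-trace of P vanishes, [contract34] leaves only the terms with the Ricci operator,
    multiplied by the nonzero [lam]. *)
Lemma proj14_contract x2 x3 x y :
  proj4 x x2 x3 (A y) - proj4 y x2 x3 (A x)
  + (proj4 (A y) x2 x3 x - proj4 (A x) x2 x3 y) = 0.
Proof.
have [P1 P2 P3 P4] := proj4_multilinear.
pose F y1 y2 y3 y4 := proj4 y3 y1 y2 y4.
have Fml : multilinear4 F.
  by split=> y1 y2 y3 b u v; rewrite /F (P1, P2, P3, P4).
have HF x1 x4 : deriv4 (K x y) F x2 x3 x1 x4
    = lam * deriv4 (wedge (ST a) x y) F x2 x3 x1 x4.
  transitivity (deriv4 (K x y) proj4 x1 x2 x3 x4).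
    by rewrite /deriv4 /F; ring.
  by rewrite curv_proj4 /deriv4 /F; ring.
have /= := contract34 ca Fml HF; rewrite /F !gtrace_proj14.
move=> E; apply: (mulfI lam_neq0); rewrite mulr0.
by move: E; rewrite !mulr0 !(addr0, subr0, add0r) => <-.
Qed.

(** The (3,4)-trace of P vanishes as well, so again only the terms with the Ricci operator survive.
    Their R-parts cancel in pairs by skewness in the last two arguments, and what is left of wedge_S
    is an identity in g, S and S^2 alone. *)
Lemma ric_minors x1 x2 x y :
  2 * (S x1 x * S x2 y - S x2 x * S x1 y)
  = 'g x1 x * S (A x2) y - 'g x2 x * S (A x1) y
    + S (A x1) x * 'g x2 y - S (A x2) x * 'g x1 y.
Proof.
have /= := contract34 ca proj4_multilinear
  (fun x3 x4 => curv_proj4 x1 x2 x3 x4 x y).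
rewrite !gtrace_proj34.
move=> E.
have {E} : proj4 x1 x2 x (A y) - proj4 x1 x2 y (A x)
    + (proj4 x1 x2 (A y) x - proj4 x1 x2 (A x) y) = 0.
  apply: (mulfI lam_neq0); rewrite mulr0.
  by move: E; rewrite !mulr0 !(addr0, subr0, add0r) => <-.
rewrite /proj4 (rm_skew34 ca x1 x2 x) (rm_skew34 ca x1 x2 y).
rewrite -!(ric_op_selfadjoint ca) !(ric_opP ca).
rewrite !(ric_sym ca _ (A _)) ?(ric2_sym ca x x1) ?(ric2_sym ca y x1).
rewrite ?(ric2_sym ca x x2) ?(ric2_sym ca y x2).
move/(congr1 ( *%R (n%:R - 1))); rewrite mulr0 => E.
by apply/eqP; rewrite -subr_eq0 -E; apply/eqP; field.
Qed.

(** Trace of [ric_minors] over x1 and x; this is (vi) before kappa^(2) is eliminated by a second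
    trace in [scal2_eq]. *)
Lemma ric2_quadratic x y :
  n%:R * S (A x) y - 2 * scal a * S x y + scal2 a * 'g x y = 0.
Proof.
have := eq_gtrace (gm a) (fun u v => ric_minors u x v y).
rewrite gtraceZ !(gtraceD, gtraceN, gtraceB).
rewrite !gtraceZr (gtrace_gprod Gsym Gunit) gtrace_ric (gtrace_ric2 ca).
rewrite (gtrace_ric_dualC ca x (Sl y)).
rewrite (gtrace_dualC Gsym Gunit x (ric2_scalarl ca y)).
rewrite (gtrace_ric_dualC ca (A x) (gl y)) (ric_opP ca) => E.
apply/eqP; rewrite -oppr_eq0 -(subrr (2 * (scal a * S x y - S (A x) y))) {2}E.
by apply/eqP; ring.
Qed.

Lemma scal2_eq : n%:R * scal2 a = scal a ^+ 2.
Proof.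
have := eq_gtrace (gm a) ric2_quadratic.
rewrite !(gtraceD, gtraceN, gtraceB) !gtraceZ gtrace_ric (gtrace_ric2 ca).
rewrite (gtrace_gprod Gsym Gunit) gtrace0.
by move=> E; lra.
Qed.

Lemma proj4_skew12 x1 x2 x3 x4 : proj4 x1 x2 x3 x4 = - proj4 x2 x1 x3 x4.
Proof. by rewrite /proj4 (rm_skew12 ca); ring. Qed.

(** In a trace of [proj14_contract], the other three terms vanish: one by skewness of P in its first
    two arguments, one as a (1,4)-trace of P, and one because the Ricci operator, being
    self-adjoint, can be moved to the other of two skew slots. *)
Lemma proj4_ric_trace x y : tr (fun u v => proj4 x v y (A u)) = 0.
Proof.
move: proj4_skew12 gtrace_proj14 (mlin1 proj4_multilinear) (mlin2 proj4_multilinear)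
  (eq_gtrace (gm a) (fun u v => proj14_contract v y u x)).
set F := proj4; move: F => F sF trF F1 F2.
rewrite !(gtraceD, gtraceN) gtrace0.
have -> : tr (fun u v => F u v y (A x)) = 0.
  have : tr (fun u v => F u v y (A x)) = - tr (fun u v => F u v y (A x)).
    by rewrite {1}(gtraceC Gsym) -gtraceN; apply: eq_gtrace => u v; exact: sF.
  by lra.
have -> : tr (fun u v => F (A x) v y u) = 0.
  under eq_gtrace do rewrite sF.
  by rewrite gtraceN (gtraceC Gsym) trF oppr0.
have -> : tr (fun u v => F (A u) v y x) = 0.
  have : tr (fun u v => F (A u) v y x) = - tr (fun u v => F (A u) v y x).
    rewrite -gtraceN (gtrace_selfadjoint Gsym Gunit (B := fun p q => F p q y x)) //.
      by rewrite [LHS](gtraceC Gsym); apply: eq_gtrace => u v; exact: sF.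
    exact: ric_op_selfadjoint.
  by lra.
by lra.
Qed.

(** Expanding P in [proj4_ric_trace], the R-part contributes -E, and the two terms of wedge_S
    contribute S^2 and kappa S. *)
Lemma ET_eq x y : (n%:R - 1) * ET a [tuple x; y] = scal a * S x y - S (A x) y.
Proof.
have := proj4_ric_trace x y.
rewrite /proj4 gtraceB gtraceZ gtraceB.
have -> : tr (fun u v => r x v y (A u)) = - ET a [tuple x; y].
  rewrite -gtrace_rm_ric -gtraceN (gtraceC Gsym).
  by apply: eq_gtrace => u v; rewrite (rm_skew12 ca).
have -> : tr (fun u v => S v y * 'g x (A u)) = S (A x) y.
  rewrite -(gtrace_ric_dual ca x (Sl y)); apply: eq_gtrace => u v.
  by rewrite -(ric_op_selfadjoint ca) (ric_opP ca) mulrC.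
have -> : tr (fun u v => S x y * 'g v (A u)) = S x y * scal a.
  rewrite gtraceZ -gtrace_ric; congr (_ * _); apply: eq_gtrace => u v.
  by rewrite gC (ric_opP ca).
move/(congr1 ( *%R (n%:R - 1))); rewrite mulr0 => E.
by apply/eqP; rewrite -subr_eq0 -oppr_eq0 -E; apply/eqP; field.
Qed.

Lemma curv_ric x1 x4 x y :
  n%:R * (S (K x y x1) x4 + S x1 (K x y x4))
  = lam * scal a * ('g y x1 * S x x4 - 'g x x1 * S y x4
                    + 'g y x4 * S x1 x - 'g x x4 * S x1 y).
Proof.
rewrite curv_ric_contract.
(* The R-parts agree with those of [proj14_contract] after flipping both skew pairs, and the
   wedge_S-parts of the two expressions differ exactly by [ric_minors]. *)
have -> : proj4 x1 x (A y) x4 - proj4 x1 y (A x) x4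
    + proj4 x1 (A y) x x4 - proj4 x1 (A x) y x4 = 0.
  have := proj14_contract x1 x4 x y; have := ric_minors x1 x4 x y.
  rewrite /proj4 !(rm_skew12 ca x1) !(rm_skew34 ca _ _ _ x4).
  rewrite -!(ric_op_selfadjoint ca) !(ric_opP ca) !(ric_sym ca _ (A _)).
  rewrite ?(ric2_sym ca x x1, ric2_sym ca x x4, ric2_sym ca y x1, ric2_sym ca y x4,
    ric2_sym ca y x).
  rewrite ?(ric_sym ca x x1, ric_sym ca x x4, ric_sym ca y x1, ric_sym ca y x4,
    ric_sym ca y x).
  rewrite ?(gC x x1, gC x x4, gC y x1, gC y x4).
  move=> /(congr1 ( *%R c)) /eqP; rewrite -subr_eq0 => /eqP E E'.
  by rewrite -[RHS](addr0 0) -{1}E' -E; ring.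
by rewrite (ric_sym ca y x1) (ric_sym ca x x1) !(gC _ x1) !(gC _ x4)
  (ric_sym ca y x4) (ric_sym ca x x4); ring.
Qed.

(** The trace of [curv_ric] reads n (S^2 - E) = lam kappa (n S - kappa g). Multiplied by n - 1, with
    E eliminated by [ET_eq] and S^2 by [ric2_quadratic], the left side becomes kappa (n S - kappa
    g). *)
Lemma lam_scal_einstein x y :
  ((n%:R - 1) * lam - 1) * scal a * (n%:R * S x y - scal a * 'g x y) = 0.
Proof.
have := eq_gtrace (gm a) (fun u v => curv_ric u y x v).
rewrite !gtraceZ !(gtraceD, gtraceN) !gtraceZr.
have -> : tr (fun u v => 'g v u) = n%:R by rewrite (gtraceC Gsym) gtrace_gprod.
have -> : tr (fun u v => S (K x v u) y) = S (A x) y.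
  rewrite (ric2_sym ca) (ric_sym ca) /ric (gtraceC Gsym); apply: eq_gtrace => u v.
  rewrite -/(S _ _) (ric_sym ca) -(ric_opP ca) gC (curv_endoP ca).
  by rewrite (rm_skew12 ca) (rm_skew34 ca) opprK.
have -> : tr (fun u v => S u (K x v y)) = - ET a [tuple x; y].
  rewrite -gtrace_rm_ric -gtraceN (gtraceC Gsym); apply: eq_gtrace => u v.
  by rewrite -(ric_opP ca) gC (curv_endoP ca) (rm_skew12 ca).
have -> : tr (fun u v => 'g v y * S u x) = S x y.
  rewrite (ric_sym ca) -(gtrace_dualC Gsym Gunit y (Sl x)).
  by apply: eq_gtrace => u v; rewrite gC.
rewrite (gtrace_dual Gunit x (Sl y)) gtraceZ gtrace_ric => E.
transitivity ((n%:R - 1) * (lam * scal a * (n%:R * S x y - S x y + S x y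
    - 'g x y * scal a)) - scal a * (n%:R * S x y) + scal a ^+ 2 * 'g x y).
  by ring.
rewrite -E -scal2_eq.
transitivity (n%:R * ((n%:R - 1) * S (A x) y - (n%:R - 1) * ET a [tuple x; y]
    - scal a * S x y + scal2 a * 'g x y)); first by ring.
rewrite ET_eq.
transitivity (n%:R * (n%:R * S (A x) y - 2 * scal a * S x y + scal2 a * 'g x y)).
  by ring.
by rewrite ric2_quadratic mulr0.
Qed.

End Projective.

(** * The clauses of the theorem at one point *)

Section Pointwise.
Context {R : realType} {n : nat} (a : geom R n) (ca : curvature_like a).
Hypothesis n_ge3 : (3 <= n)%N.
Local Notation "'g" := (gprod (gm a)).
Local Notation S := (ric a).
Local Notation A := (ric_op a).
Local Notation c := ((n%:R - 1)^-1 : R).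
Local Notation K := (curv_endo a).

Context (L : R).
Hypothesis PP : dot (gm a) (PT a) (PT a) = L *: tachibana (ST a) (PT a).

Let c_neq0 : c != 0. Proof. by rewrite invr_neq0 // natrB1_neq0. Qed.

Lemma curv_PT : dot (gm a) (RT a) (PT a) = (L + c) *: tachibana (ST a) (PT a).
Proof.
apply/funext => X; have := congr1 (fun T : tensor R n 6 => T X) PP.
rewrite [in LHS]PT_E (dot_PT ca (proj4_multilinear ca)) -PT_E.
by rewrite tensorBZE !tensorZE => E; rewrite mulrDl -E; ring.
Qed.

Lemma curv_PT_split X :
  dot (gm a) (RT a) (RT a) X - c * dot (gm a) (RT a) (wedgeST a) X
  = (L + c) * (tachibana (ST a) (RT a) X - c * tachibana (ST a) (wedgeST a) X).
Proof.
have := congr1 (fun T : tensor R n 6 => T X) curv_PT.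
by rewrite tensorZE dot_RT /tachibana /PT !actionB !tensorBZE.
Qed.

Lemma funext_iff k (F F' H H' : tensor R n k) :
  (forall X, F X = F' X <-> H X = H' X) -> F = F' <-> H = H'.
Proof.
by move=> FH; split=> E; apply/funext => X; apply/FH; rewrite E.
Qed.

(** Since P.R = R.R - c Q(S,R), the first equation says R.R = (L + c) Q(S,R); subtracting this from
    [curv_PT_split] leaves a nonzero multiple of the second. *)
Lemma PT_RT_iff :
  dot (gm a) (PT a) (RT a) = L *: tachibana (ST a) (RT a) <->
  dot (gm a) (RT a) (wedgeST a) = (L + c) *: tachibana (ST a) (wedgeST a).
Proof.
apply: funext_iff => X; rewrite (dot_PT ca (rm_mlin ca)) -[tensor4 _]/(RT a).
rewrite tensorBZE !tensorZE; have := curv_PT_split X.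
move: c c_neq0 (dot _ (RT a) (RT a) X) (dot _ _ (wedgeST a) X)
  (tachibana _ (RT a) X) (tachibana _ (wedgeST a) X) => b b0 d w t s E.
split=> [E'|wE]; last by move: E; rewrite wE; lra.
by apply: (mulfI b0); lra.
Qed.

(** Subtracting R.R = L Q(S,R) from [curv_PT_split] leaves a nonzero multiple of the second
    equation. *)
Lemma RT_RT_iff :
  dot (gm a) (RT a) (RT a) = L *: tachibana (ST a) (RT a) <->
  dot (gm a) (RT a) (wedgeST a) + tachibana (ST a) (RT a)
  = (L + c) *: tachibana (ST a) (wedgeST a).
Proof.
apply: funext_iff => X; rewrite !tensorZE.
rewrite -[(_ + _) X]/(dot (gm a) (RT a) (wedgeST a) X + tachibana (ST a) (RT a) X).
have := curv_PT_split X.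
move: c c_neq0 (dot _ (RT a) (RT a) X) (dot _ _ (wedgeST a) X)
  (tachibana _ (RT a) X) (tachibana _ (wedgeST a) X) => b b0 d w t s E.
split=> [E'|/(congr1 ( *%R b)) E']; last by lra.
by apply: (mulfI b0); lra.
Qed.

(** By [curv_PT] the two sides of the first equation differ by c Q(S,P). *)
Lemma RT_PT_iff :
  dot (gm a) (RT a) (PT a) = L *: tachibana (ST a) (PT a) <->
  tachibana (ST a) (PT a) = 0.
Proof.
rewrite curv_PT; apply: funext_iff => X; rewrite !tensorZE mulrDl.
rewrite -[(0 : tensor R n 6) X]/(0 : R).
split=> [/eqP|->]; last by rewrite !mulr0 addr0.
by rewrite -subr_eq0 addrC addKr mulf_eq0 (negPf c_neq0) => /eqP.
Qed.

Lemma curv_ric_tensor :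
  (n%:R * (n%:R - 1)) *: dot (gm a) (RT a) (ST a)
  = (scal a * (1 + (n%:R - 1) * L)) *: tachibana (gT a) (ST a).
Proof.
apply: tensor_ext4 => x1 x4 x y.
rewrite !tensorZE dot_RT /tachibana !action_tensor2E /wedge.
rewrite (scalar_lincombB (ric_scalarl ca x4)) (scalar_lincombB (ric_scalarr ca x1)).
have nz := natrB1_neq0 n_ge3 : n%:R - 1 != 0 :> R.
have : n%:R * (S (K x y x1) x4 + S x1 (K x y x4))
  = (L + c) * scal a * ('g y x1 * S x x4 - 'g x x1 * S y x4
                    + 'g y x4 * S x1 x - 'g x x4 * S x1 y).
  (* Clause (iv) holds for every L: when L + c = 0, where [curv_ric] does not apply,
     [curv_ric_contract] makes both sides 0. *)
  have [l0|l0] := eqVneq (L + c) 0; last exact: curv_ric curv_PT l0 _ _ _ _.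
  by rewrite (curv_ric_contract ca n_ge3 curv_PT) l0 !mul0r.
rewrite -![gT a _]/('g _ _) => E.
transitivity (- (n%:R - 1) * (n%:R * (S (K x y x1) x4 + S x1 (K x y x4)))).
  by ring.
by rewrite E; field.
Qed.

Hypothesis L_neq : L != - c.

Let lam_neq0 : L + c != 0. Proof. by rewrite addr_eq0. Qed.

Lemma ET_tensor : (n%:R - 1) *: ET a = scal a *: ST a - S2T a.
Proof.
apply: tensor_ext2 => x y; rewrite -[S2T a]scale1r tensorBZE !tensorZE.
rewrite (ET_eq ca n_ge3 curv_PT lam_neq0) mul1r.
by rewrite -[S2T a _]/('g (A (A x)) y) (ric_opP ca).
Qed.

Lemma S2T_tensor :
  n%:R ^+ 2 *: S2T a - (2 * n%:R * scal a) *: ST a + scal a ^+ 2 *: gT a = 0.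
Proof.
apply: tensor_ext2 => x y.
transitivity (n%:R ^+ 2 * 'g (A (A x)) y - 2 * n%:R * scal a * S x y
  + scal a ^+ 2 * 'g x y); first by [].
rewrite -(scal2_eq ca n_ge3 curv_PT lam_neq0) (ric_opP ca).
rewrite -[RHS](mulr0 n%:R) -(ric2_quadratic ca n_ge3 curv_PT lam_neq0 x y).
by ring.
Qed.

Lemma scal2_div : scal2 a = scal a ^+ 2 / n%:R.
Proof.
rewrite -(scal2_eq ca n_ge3 curv_PT lam_neq0) mulrAC divff ?mul1r //.
exact: dim_neq0.
Qed.

Lemma einstein_defect :
  (L * scal a) *: (n%:R *: ST a - scal a *: gT a) = 0.
Proof.
apply: tensor_ext2 => x y.
transitivity (L * scal a * (n%:R * S x y - scal a * 'g x y)); first by [].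
have nz := natrB1_neq0 n_ge3 : n%:R - 1 != 0 :> R.
(* With lam = L + c, the factor (n - 1) lam - 1 is (n - 1) L. *)
have E := lam_scal_einstein ca n_ge3 curv_PT lam_neq0 x y.
apply: (mulfI nz); rewrite -[RHS]/((n%:R - 1) * 0) mulr0 -{}E.
by field.
Qed.

Lemma einstein_of_definite :
  (forall v : 'rV[R]_n, v != 0 -> 0 < 'g v v) ->
  ST a = (scal a / n%:R) *: gT a.
Proof.
move=> gpos.
have n0 := dim_neq0 n_ge3 : n%:R != 0 :> R.
(* For W = n A - kappa, self-adjointness turns g(Wx, Wx) into n times the quadratic identity at (x,
   x), so Wx cannot be nonzero. *)
have W0 x : n%:R *: A x - scal a *: x = 0.
  apply/eqP; apply: contraT => /gpos; rewrite lt0r => /andP[+ _].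
  have gl := @gprod_scalarl R n (gm a); have gr := @gprod_scalarr R n (gm a).
  rewrite (scalar_lincombB (gl _)) !(scalar_lincombB (gr _)).
  rewrite -!(ric_op_selfadjoint ca) !(ric_opP ca) => /negP[]; apply/eqP.
  transitivity (n%:R * (n%:R * S (A x) x - 2 * scal a * S x x)
    + scal a ^+ 2 * 'g x x); first by ring.
  rewrite -(scal2_eq ca n_ge3 curv_PT lam_neq0) -[RHS](mulr0 n%:R).
  by rewrite -(ric2_quadratic ca n_ge3 curv_PT lam_neq0 x x); ring.
apply: tensor_ext2 => x y; transitivity (S x y); first by [].
rewrite tensorZE -[gT a _]/('g x y).
have := scalar_lincombB (@gprod_scalarl R n (gm a) y) n%:R (scal a) (A x) x.
rewrite W0 (ric_opP ca) /gprod !mul0mx mxE -/(gprod _ _ _) => E.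
by apply: (mulfI n0); rewrite mulrA mulrCA divff // mulr1; lra.
Qed.

End Pointwise.

(** * Symmetries of the Riemann tensor of a smooth metric *)

Section SymmetryOfSecondDerivatives.
Context {R : realType} {V : normedModType R}.
Implicit Types (f : V -> R) (u v x : V).

Lemma is_derive_line f x u (s : R) : derivable f (x + s *: u) u ->
  is_derive s 1 (fun t => f (x + t *: u)) ('D_u f (x + s *: u)).
Proof.
have E : (fun h : R => h^-1 *: (f (x + (h *: 1 + s) *: u) - f (x + s *: u)))
    = (fun h => h^-1 *: (f (h *: u + (x + s *: u)) - f (x + s *: u))).
  apply/funext => h; congr (_ *: (f _ - _)).
  by rewrite scalerDl [h *: 1]mulr1 addrCA.
by move=> df; split; rewrite /derivable /derive E.
Qed.

Lemma MVT_line f x u (h : R) : 0 < h ->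
  (forall s, 0 <= s <= h -> derivable f (x + s *: u) u) ->
  exists2 s, 0 <= s <= h & f (x + h *: u) - f x = h * 'D_u f (x + s *: u).
Proof.
move=> h0 df.
have [| |s] := MVT h0 (f := fun t => f (x + t *: u))
    (df := fun t => 'D_u f (x + t *: u)).
- move=> s; rewrite in_itv /= => /andP[s0 sh]; apply: is_derive_line.
  by apply: df; rewrite !ltW.
- apply: derivable_within_continuous => s; rewrite in_itv /= => sh.
  by have [] := is_derive_line (df s sh).
rewrite in_itv /= => /andP[s0 sh]; rewrite subr0 scale0r addr0 mulrC => ->.
by exists s => //; rewrite !ltW.
Qed.

(** The mean value theorem is applied twice: along u to the difference of f and its translate by
    [h *: v], then along v to the derivative ['D_u f]. *)
Lemma second_difference f x u v (h : R) : 0 < h ->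
  (forall s t, 0 <= s <= h -> 0 <= t <= h ->
     derivable f (x + s *: u + t *: v) u /\
     derivable ('D_u f) (x + s *: u + t *: v) v) ->
  exists s t, [/\ 0 <= s <= h, 0 <= t <= h &
    f (x + h *: u + h *: v) - f (x + h *: u) - (f (x + h *: v) - f x)
    = h ^+ 2 * 'D_v ('D_u f) (x + s *: u + t *: v)].
Proof.
move=> h0 df.
have hh : 0 <= h <= h by rewrite lexx ltW.
have h00 : 0 <= (0 : R) <= h by rewrite lexx ltW.
pose fv y := f (y + h *: v).
have E y : (fun k : R => k^-1 *: (fv (k *: u + y) - fv y))
    = (fun k => k^-1 *: (f (k *: u + (y + h *: v)) - f (y + h *: v))).
  by apply/funext => k; rewrite /fv addrA.
have dfv y : derivable f (y + h *: v) u -> derivable fv y u.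
  by rewrite /derivable E.
have Dfv y : 'D_u fv y = 'D_u f (y + h *: v) by rewrite /derive E.
have df0 s : 0 <= s <= h -> derivable f (x + s *: u) u.
  by move=> sh; have [] := df s 0 sh h00; rewrite scale0r addr0.
have [|s sh] := MVT_line (f := fv - f) (x := x) (u := u) h0.
  move=> s' sh; apply: derivableB; last exact: df0.
  exact: dfv (df s' h sh hh).1.
rewrite deriveB; [|exact: dfv (df s h sh hh).1|exact: df0].
rewrite Dfv => Es.
have [t ht Et] := MVT_line (f := 'D_u f) (x := x + s *: u) (u := v) h0
  (fun t th => (df s t sh th).2).
by exists s, t; split=> //; rewrite expr2 -mulrA -Et -Es.
Qed.

(** Schwarz's theorem: the second difference of f over a small parallelogram equals h^2 times either
    mixed derivative at some point of it, and both are continuous at x. *)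
Lemma derive_comm f u v x :
  (\forall y \near x, [/\ derivable f y u, derivable f y v,
     derivable ('D_u f) y v & derivable ('D_v f) y u]) ->
  'D_v ('D_u f) y @[y --> x] --> 'D_v ('D_u f) x ->
  'D_u ('D_v f) y @[y --> x] --> 'D_u ('D_v f) x ->
  'D_v ('D_u f) x = 'D_u ('D_v f) x.
Proof.
move=> df cu cv; apply/eqP; rewrite -subr_eq0 -normr_le0.
apply/ler_addgt0Pl => e e0; rewrite addr0.
have e20 : 0 < e / 2 by rewrite divr_gt0.
have /nbhs_normP[d /= d0 dP] : \forall y \near x,
    [/\ [/\ derivable f y u, derivable f y v,
     derivable ('D_u f) y v & derivable ('D_v f) y u],
     `|'D_v ('D_u f) x - 'D_v ('D_u f) y| < e / 2 &
     `|'D_u ('D_v f) x - 'D_u ('D_v f) y| < e / 2].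
  move: cu cv => /cvgrPdist_lt/(_ _ e20) cu /cvgrPdist_lt/(_ _ e20) cv.
  apply: filterS3 df cu cv => y dy cuy cvy.
  by split; [exact: dy|exact: cuy|exact: cvy].
(* This makes h (|u| + |v|) < d, so the parallelogram stays in the ball of radius d; the summand 1
   keeps the denominator positive. *)
pose h := d / (1 + `|u| + `|v|).
have D0 : 0 < 1 + `|u| + `|v| by rewrite -addrA ltr_pwDl // addr_ge0.
have h0 : 0 < h by rewrite divr_gt0.
have near_x s t : 0 <= s <= h -> 0 <= t <= h ->
    [/\ [/\ derivable f (x + s *: u + t *: v) u,
      derivable f (x + s *: u + t *: v) v,
      derivable ('D_u f) (x + s *: u + t *: v) v &
      derivable ('D_v f) (x + s *: u + t *: v) u],
     `|'D_v ('D_u f) x - 'D_v ('D_u f) (x + s *: u + t *: v)| < e / 2 &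
     `|'D_u ('D_v f) x - 'D_u ('D_v f) (x + s *: u + t *: v)| < e / 2].
  move=> /andP[s0 sh] /andP[t0 th]; apply: dP => /=.
  rewrite -addrA opprD addNKr normrN (le_lt_trans (ler_normD _ _)) //.
  rewrite !normrZ (ger0_norm s0) (ger0_norm t0).
  rewrite (@le_lt_trans _ _ (h * (`|u| + `|v|))) //.
    by rewrite mulrDr lerD // ler_wpM2r.
  by rewrite /h mulrAC ltr_pdivrMr // ltr_pM2l // -addrA ltrDr.
have [|s [t [sh th E]]] := @second_difference f x u v h h0.
  by move=> s t sh th; have [[dfu _ du _] _ _] := near_x s t sh th;
    split; [exact: dfu|exact: du].
have [|t' [s' [th' sh' E']]] := @second_difference f x v u h h0.
  move=> t' s' th' sh'; have [[_ dfv _ dv] _ _] := near_x s' t' sh' th'.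
  by rewrite addrAC; split; [exact: dfv|exact: dv].
(* The second difference is symmetric in u and v, so both evaluations have the same left-hand
   side. *)
have {E E'} E : 'D_v ('D_u f) (x + s *: u + t *: v)
    = 'D_u ('D_v f) (x + s' *: u + t' *: v).
  have h20 : h ^+ 2 != 0 by rewrite expf_neq0 // gt_eqF.
  apply: (mulfI h20); apply: (etrans (esym E)).
  rewrite (addrAC x (s' *: u)); apply: etrans E'.
  by rewrite (addrAC x (h *: v)); ring.
have [_ ds _] := near_x s t sh th; have [_ _ ds'] := near_x s' t' sh' th'.
rewrite -[X in `|X|](subrKA ('D_v ('D_u f) (x + s *: u + t *: v))).
apply: (le_trans (ler_normD _ _)); rewrite [leRHS]splitr; apply: lerD.
  exact: ltW ds.
rewrite E distrC; exact: ltW ds'.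
Qed.

End SymmetryOfSecondDerivatives.

(** * Derivability of sums, products, determinants and inverse matrices *)

Section DerivableAlgebra.
Context {R : realType} {V : normedModType R} (x v : V).

Lemma derivable_mul (f h : V -> R) : derivable f x v -> derivable h x v ->
  derivable (fun y => f y * h y) x v.
Proof. by move=> df dh; exact: (derivableM df dh). Qed.

Lemma derivable_mulc (f : V -> R) a : derivable f x v ->
  derivable (fun y => a * f y) x v.
Proof. by move=> df; exact: (derivableM (derivable_cst a x v) df). Qed.

Lemma is_derive_bigsum (I : Type) (s : seq I) (F : I -> V -> R) (dF : I -> R) :
  (forall i, is_derive x v (F i) (dF i)) ->
  is_derive x v (fun y => \sum_(i <- s) F i y) (\sum_(i <- s) dF i).
Proof.
move=> hF; elim: s => [|i s IHs].
  rewrite big_nil (_ : (fun y => _) = cst 0); first exact: is_derive_cst.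
  by apply/funext => y; rewrite big_nil.
rewrite big_cons (_ : (fun y => _) = F i + (fun y => \sum_(j <- s) F j y)).
  exact: is_deriveD.
by apply/funext => y; rewrite big_cons.
Qed.

Lemma derivable_bigprod (I : Type) (s : seq I) (F : I -> V -> R) :
  (forall i, derivable (F i) x v) -> derivable (fun y => \prod_(i <- s) F i y) x v.
Proof.
move=> hF; elim: s => [|i s IHs].
  rewrite (_ : (fun y => _) = cst 1); first exact: derivable_cst.
  by apply/funext => y; rewrite big_nil.
rewrite (_ : (fun y => _) = F i * (fun y => \prod_(j <- s) F j y)).
  exact: (derivableM (hF i) IHs).
by apply/funext => y; rewrite big_cons.
Qed.

Lemma derivable_bigsum (I : Type) (s : seq I) (F : I -> V -> R) :
  (forall i, derivable (F i) x v) -> derivable (fun y => \sum_(i <- s) F i y) x v.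
Proof.
by move=> hF; have [] := is_derive_bigsum s (fun i => derivableP (hF i)).
Qed.

Lemma derivable_det m (M : V -> 'M[R]_m) :
  (forall i j, derivable (fun y => M y i j) x v) ->
  derivable (fun y => \det (M y)) x v.
Proof.
move=> dM; apply: derivable_bigsum => s.
apply: derivable_mulc.
by apply: derivable_bigprod => i; exact: dM.
Qed.

Lemma derivable_invmx m (M : V -> 'M[R]_m) :
  (forall i j, derivable (fun y => M y i j) x v) ->
  (\forall y \near x, M y \in unitmx) ->
  forall i j, derivable (fun y => invmx (M y) i j) x v.
Proof.
move=> dM uM i j.
(* Cramer's formula, whose adjugate is the transposed cofactor matrix. It agrees with [invmx] on
   invertible matrices, hence near x. *)
pose F y := (\det (M y))^-1 * cofactor (M y) j i.
have FE : {near x, F =1 fun y => invmx (M y) i j}.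
  by apply: filterS uM => y uMy; rewrite /F /invmx uMy !mxE.
apply: (near_eq_derivable FE).
apply: derivable_mul.
  apply: derivableV; last exact: derivable_det.
  by have := nbhs_singleton uM; rewrite unitmxE unitfE.
apply: derivable_mulc.
apply: derivable_det => k l.
rewrite (_ : (fun y => _) = fun y => M y (lift j k) (lift i l)) //.
by apply/funext => y; rewrite !mxE.
Qed.

End DerivableAlgebra.

(** * Christoffel symbols and the symmetries of the curvature *)

Section RiemannSymmetries.
Context {R : realType} {n : nat} (G : 'rV[R]_n -> 'M[R]_n) (U : set 'rV[R]_n).
Hypotheses (Uopen : open U)
  (Gsmooth : forall i j, smooth_on U (fun x => G x i j))
  (Gsym : forall x, U x -> (G x)^T = G x)
  (Gunit : forall x, U x -> G x \in unitmx).
Local Notation e_ i := (delta_mx 0 i : 'rV[R]_n).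
Local Notation dG k i j x := (pd k (fun y => G y i j) x).
Local Notation Gamma := (christoffel G).

Lemma near_open x (P : 'rV[R]_n -> Prop) :
  U x -> (forall y, U y -> P y) -> \forall y \near x, P y.
Proof.
move=> Ux UP; have : nbhs x U by apply: open_nbhs_nbhs; split.
exact: filterS.
Qed.

Lemma near_eq_pd (f h : 'rV[R]_n -> R) x k :
  U x -> (forall y, U y -> f y = h y) -> pd k f x = pd k h x.
Proof. by move=> Ux fh; apply: near_eq_derive; exact: near_open. Qed.

Lemma pd_comm f x i j : smooth_on U f -> U x ->
  pd i (pd j f) x = pd j (pd i f) x.
Proof.
move=> sf Ux; apply: (@derive_comm _ _ f (e_ j) (e_ i)).
- apply: near_open Ux _ => y Uy; split.
  + exact: (sf [::] y Uy).2.
  + exact: (sf [::] y Uy).2.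
  + exact: (sf [:: j] y Uy).2.
  + exact: (sf [:: i] y Uy).2.
- exact: (sf [:: i; j] x Ux).1.
- exact: (sf [:: j; i] x Ux).1.
Qed.

Lemma pdD (f h : 'rV[R]_n -> R) k x :
  derivable f x (e_ k) -> derivable h x (e_ k) ->
  pd k (fun y => f y + h y) x = pd k f x + pd k h x.
Proof. by move=> df dh; exact: (deriveD df dh). Qed.

Lemma pdM (f h : 'rV[R]_n -> R) k x :
  derivable f x (e_ k) -> derivable h x (e_ k) ->
  pd k (fun y => f y * h y) x = pd k f x * h x + f x * pd k h x.
Proof.
move=> df dh; apply: (etrans (deriveM df dh)).
by rewrite addrC; congr (_ + _); exact: mulrC.
Qed.

Lemma pd_sum (F : 'I_n -> 'rV[R]_n -> R) k x :
  (forall l, derivable (F l) x (e_ k)) ->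
  pd k (fun y => \sum_l F l y) x = \sum_l pd k (F l) x.
Proof.
move=> dF; have [_ E] :=
  is_derive_bigsum (index_enum 'I_n) (fun l => derivableP (dF l)).
exact: E.
Qed.

(* Otherwise unification compares distinct derivatives by unfolding limits. *)
#[local] Opaque pd.

Lemma entry_sym x i j : U x -> G x i j = G x j i.
Proof. by move=> Ux; rewrite -{1}(Gsym Ux) mxE. Qed.

Lemma derivable_entry x i j k : U x -> derivable (fun y => G y i j) x (e_ k).
Proof. by move=> Ux; exact: (Gsmooth i j [::] Ux).2. Qed.

Lemma derivable_pd_entry x i j k l : U x ->
  derivable (pd l (fun y => G y i j)) x (e_ k).
Proof. by move=> Ux; exact: (Gsmooth i j [:: l] Ux).2. Qed.

Lemma pd_entry_sym x i j k : U x -> dG k i j x = dG k j i x.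
Proof. by move=> Ux; apply: near_eq_pd => // y Uy; exact: entry_sym. Qed.

(** Christoffel symbols of the first kind, g(nabla_i d_j, d_m). Working with lowered indices avoids
    differentiating the inverse metric explicitly. *)
Definition christoffel1 (i j m : 'I_n) x : R :=
  2^-1 * (dG i j m x + dG j i m x - dG m i j x).

Lemma christoffelE i j k x :
  Gamma i j k x = \sum_l invmx (G x) k l * christoffel1 i j l x.
Proof.
rewrite /christoffel mulr_sumr; apply: eq_bigr => l _.
by rewrite mulrCA.
Qed.

#[local] Opaque christoffel.

Lemma christoffel_lower i j m x : U x ->
  \sum_l Gamma i j l x * G x l m = christoffel1 i j m x.
Proof.
move=> Ux.
transitivity (\sum_p (G x *m invmx (G x)) m p * christoffel1 i j p x).
  under eq_bigr => l _ do rewrite christoffelE mulr_suml.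
  rewrite exchange_big; apply: eq_bigr => p _; rewrite mxE mulr_suml.
  by apply: eq_bigr => l _; rewrite (entry_sym m l Ux); ring.
rewrite mulmxV ?Gunit // (bigD1 m) //= mxE eqxx mul1r big1 ?addr0 // => p pm.
by rewrite mxE eq_sym (negPf pm) mul0r.
Qed.

Lemma christoffel_sym i j k x : U x -> Gamma i j k x = Gamma j i k x.
Proof.
move=> Ux; rewrite !christoffelE; apply: eq_bigr => l _; congr (_ * _).
by rewrite /christoffel1 (pd_entry_sym i j) //; ring.
Qed.

Lemma derivable_christoffel1 i j m k x : U x ->
  derivable (christoffel1 i j m) x (e_ k).
Proof.
move=> Ux; apply: derivable_mulc.
apply: derivableB; last exact: derivable_pd_entry.
by apply: derivableD; exact: derivable_pd_entry.
Qed.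

Lemma derivable_christoffel i j l k x : U x -> derivable (Gamma i j l) x (e_ k).
Proof.
move=> Ux; rewrite (_ : Gamma i j l =
    fun y => \sum_p invmx (G y) l p * christoffel1 i j p y).
  apply: derivable_bigsum => p; apply: derivable_mul.
    apply: derivable_invmx => [i' j'|]; first exact: derivable_entry.
    exact: near_open.
  exact: derivable_christoffel1.
by apply/funext => y; exact: christoffelE.
Qed.

Lemma pd_christoffel1 i j m k x : U x ->
  pd k (christoffel1 i j m) x
  = \sum_l (pd k (Gamma i j l) x * G x l m + Gamma i j l x * dG k l m x).
Proof.
move=> Ux.
rewrite -(near_eq_pd k Ux (fun y Uy => christoffel_lower i j m Uy)).
rewrite (pd_sum (F := fun l y => Gamma i j l y * G y l m)) => [|l].
  apply: eq_bigr => l _; apply: pdM; last exact: derivable_entry.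
  exact: derivable_christoffel.
apply: derivable_mul; last exact: derivable_entry.
exact: derivable_christoffel.
Qed.

(** This is nabla g = 0 in coordinates. *)
Lemma metric_compat k l m x : U x ->
  dG k l m x = christoffel1 k l m x + christoffel1 k m l x.
Proof.
by move=> Ux; rewrite /christoffel1 (pd_entry_sym m l) //; field.
Qed.

Definition curv_lower i j k m x : R := \sum_l curv_coef G i j k l x * G x l m.

(** The number g(nabla_i d_m, nabla_j d_k), whence its symmetry under exchange of the two pairs. *)
Definition gamma_pairing i m j k x : R :=
  \sum_l Gamma j k l x * christoffel1 i m l x.

Lemma gamma_pairing_sym i m j k x : U x ->
  gamma_pairing i m j k x = gamma_pairing j k i m x.
Proof.
move=> Ux; rewrite /gamma_pairing.
under eq_bigr => l _ do rewrite -christoffel_lower // mulr_sumr.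
rewrite exchange_big; apply: eq_bigr => p _.
rewrite -christoffel_lower // mulr_sumr; apply: eq_bigr => l _.
by rewrite (entry_sym l p Ux); ring.
Qed.

(** It is g(nabla_i nabla_j d_k, d_m) = d_i g(nabla_j d_k, d_m) - g(nabla_j d_k, nabla_i d_m),
    antisymmetrised in i and j. *)
Lemma curv_lowerE i j k m x : U x ->
  curv_lower i j k m x
  = pd i (christoffel1 j k m) x - pd j (christoffel1 i k m) x
    - gamma_pairing i m j k x + gamma_pairing j m i k x.
Proof.
move=> Ux.
transitivity (\sum_l pd i (Gamma j k l) x * G x l m
    - \sum_l pd j (Gamma i k l) x * G x l m
    + (\sum_p Gamma j k p x * christoffel1 i p m x
       - \sum_p Gamma i k p x * christoffel1 j p m x)).
  rewrite /curv_lower /curv_coef.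
  under eq_bigr => l _ do rewrite mulrDl mulrBl mulr_suml.
  rewrite big_split sumrB /= exchange_big /=; congr (_ + _).
  rewrite -sumrB; apply: eq_bigr => p _.
  rewrite -!christoffel_lower // !mulr_sumr -sumrB; apply: eq_bigr => l _.
  move: (Gamma i p l x) (Gamma j k p x) (Gamma j p l x) (Gamma i k p x) => a b c d.
  by ring.
(* Differentiating the lowered symbol also differentiates the metric. By [metric_compat] this gives
   two sums: one cancels the quadratic terms of the curvature, the other is the pairing. *)
have E q j' : \sum_l pd q (Gamma j' k l) x * G x l m
    = pd q (christoffel1 j' k m) x
      - (\sum_l Gamma j' k l x * christoffel1 q l m x + gamma_pairing q m j' k x).
  rewrite pd_christoffel1 // big_split /=.
  under [X in _ = _ + X - _]eq_bigr => l _ do rewrite metric_compat // mulrDr.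
  by rewrite big_split /= -/(gamma_pairing q m j' k x); ring.
apply: (etrans (congr1 (fun s => s + _)
  (congr2 (fun s t => s - t) (E i j) (E j i)))).
move: (pd i _ x) (pd j _ x) (gamma_pairing i m j k x) (gamma_pairing j m i k x).
by move=> a b c d; ring.
Qed.

(** Symmetrising [curv_lowerE] in k and m, the pairings cancel by their symmetry, and the
    derivatives combine to the commutator of d_i and d_j on g_km, which is 0. *)
Lemma curv_lower_skew34 i j k m x : U x ->
  curv_lower i j k m x = - curv_lower i j m k x.
Proof.
move=> Ux.
have E p q : pd p (christoffel1 q k m) x + pd p (christoffel1 q m k) x
    = pd p (pd q (fun y => G y k m)) x.
  rewrite -(pdD (@derivable_christoffel1 q k m p x Ux)
    (@derivable_christoffel1 q m k p x Ux)).
  by apply: (near_eq_pd p Ux) => y Uy; rewrite (metric_compat q k m Uy).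
apply/eqP; rewrite -addr_eq0 !curv_lowerE //; apply/eqP.
rewrite (gamma_pairing_sym i k j m) // (gamma_pairing_sym j k i m) //.
have := etrans (E i j) (etrans (pd_comm i j (Gsmooth k m) Ux) (esym (E j i))).
move: (pd i _ x) (pd i _ x) (pd j _ x) (pd j _ x) (gamma_pairing _ _ _ _ x)
  (gamma_pairing _ _ _ _ x) => a b c d e f.
by lra.
Qed.

Lemma curv_coef_skew12 i j k l x : curv_coef G i j k l x = - curv_coef G j i k l x.
Proof.
rewrite /curv_coef opprD opprB -sumrN; congr (_ + _); apply: eq_bigr => m _.
by rewrite opprB.
Qed.

(** The bookkeeping of the first Bianchi identity: D stands for the derivatives of the Christoffel
    symbols and T for their products, both symmetric in the lower indices of one symbol because the
    connection is torsion-free. *)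
Lemma cyclic_sum_eq0 (D : 'I_n -> 'I_n -> 'I_n -> R)
    (T : 'I_n -> 'I_n -> 'I_n -> 'I_n -> R) i j k :
  (forall p q s, D p q s = D p s q) ->
  (forall p q s m, T p q s m = T p s q m) ->
  D i j k - D j i k + \sum_m (T i j k m - T j i k m)
  + (D j k i - D k j i + \sum_m (T j k i m - T k j i m))
  + (D k i j - D i k j + \sum_m (T k i j m - T i k j m)) = 0.
Proof.
move=> Dsym Tsym; rewrite (Dsym i k) (Dsym j k) (Dsym k j) !sumrB.
rewrite (eq_bigr _ (fun m _ => Tsym i j k m)) (eq_bigr _ (fun m _ => Tsym j i k m)).
by rewrite (eq_bigr _ (fun m _ => Tsym k i j m)); ring.
Qed.

Lemma curv_coef_bianchi i j k l x : U x ->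
  curv_coef G i j k l x + curv_coef G j k i l x + curv_coef G k i j l x = 0.
Proof.
move=> Ux.
have E p q s : pd p (Gamma q s l) x = pd p (Gamma s q l) x.
  by apply: (near_eq_pd p Ux) => y Uy; exact: christoffel_sym.
apply: (cyclic_sum_eq0 (D := fun p q s => pd p (Gamma q s l) x)
  (T := fun p q s m => Gamma p m l x * Gamma q s m x) i j k E)
  => p q s m; by rewrite (christoffel_sym q s m Ux).
Qed.

Lemma curv_opE x u v w l : curv_op G x u v w 0 l =
  \sum_i u 0 i * \sum_j v 0 j * \sum_k w 0 k * curv_coef G i j k l x.
Proof.
rewrite mxE; apply: eq_bigr => i _; rewrite mulr_sumr; apply: eq_bigr => j _.
rewrite !mulr_sumr; apply: eq_bigr => k _.
by rewrite !mulrA.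
Qed.

Lemma sum_lincomb (F : 'I_n -> R) a (u v : 'rV[R]_n) :
  \sum_i (a *: u + v) 0 i * F i = a * (\sum_i u 0 i * F i) + \sum_i v 0 i * F i.
Proof.
rewrite mulr_sumr -big_split; apply: eq_bigr => i _.
by rewrite !mxE mulrDl mulrA.
Qed.

Lemma sum_delta (F : 'I_n -> R) i : \sum_j e_ i 0 j * F j = F i.
Proof.
rewrite (bigD1 i) //= mxE !eqxx mul1r big1 ?addr0 // => j ji.
by rewrite mxE (negPf ji) andbF mul0r.
Qed.

Lemma riemann_multilinear x : multilinear4 (riemann G x).
Proof.
split=> [y z w a u v|y z w a u v|y z w a u v|y z w].
- rewrite -(gprod_scalarl (G x) w a); congr (gprod _ _ _); apply/rowP => l.
  by rewrite curv_opE sum_lincomb 2!mxE -!curv_opE.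
- rewrite -(gprod_scalarl (G x) w a); congr (gprod _ _ _); apply/rowP => l.
  rewrite [RHS]mxE [X in _ = X + _]mxE !curv_opE mulr_sumr -big_split.
  apply: eq_bigr => i _ /=.
  by rewrite sum_lincomb; ring.
- rewrite -(gprod_scalarl (G x) w a); congr (gprod _ _ _); apply/rowP => l.
  rewrite [RHS]mxE [X in _ = X + _]mxE !curv_opE mulr_sumr -big_split.
  apply: eq_bigr => i _ /=.
  rewrite mulrCA -mulrDr; congr (_ * _).
  rewrite mulr_sumr -big_split; apply: eq_bigr => j _ /=.
  by rewrite sum_lincomb; ring.
- exact: gprod_scalarr.
Qed.

Lemma riemann_delta x i j k m :
  riemann G x (e_ i) (e_ j) (e_ k) (e_ m) = curv_lower i j k m x.
Proof.
rewrite /riemann /gprod trmx_delta -colE !mxE; apply: eq_bigr => l _.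
by rewrite curv_opE !sum_delta.
Qed.

Lemma multilinear4_eq0 (F : 'rV[R]_n -> _) : multilinear4 F ->
  (forall i j k m, F (e_ i) (e_ j) (e_ k) (e_ m) = 0) ->
  forall u v w z, F u v w z = 0.
Proof.
move=> [F1 F2 F3 F4] F0 u v w z.
rewrite (scalar_sum_delta (F1 _ _ _)) big1 // => i _.
rewrite (scalar_sum_delta (F2 _ _ _)) big1 ?mulr0 // => j _.
rewrite (scalar_sum_delta (F3 _ _ _)) big1 ?mulr0 // => k _.
rewrite (scalar_sum_delta (F4 _ _ _)) big1 ?mulr0 // => m _.
by rewrite F0 mulr0.
Qed.

(** By multilinearity each symmetry is checked on frame vectors. Skewness in the first pair and
    Bianchi already hold for the coefficients of R(d_i, d_j) d_k; skewness in the last pair needs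
    the lowered form. *)
Lemma riemann_curvature_like x : U x -> curvature_like (Geom (G x) (riemann G x)).
Proof.
move=> Ux; have rml := riemann_multilinear x; have [r1 r2 r3 r4] := rml.
split=> //=; [exact: Gsym|exact: Gunit|..].
- move=> u v w z; apply/eqP; rewrite -addr_eq0; apply/eqP.
  apply: (multilinear4_eq0 (F := fun u v w z => riemann G x u v w z
    + riemann G x v u w z)).
    by split=> y1 y2 y3 a s t; rewrite (r1, r2, r3, r4) (r1, r2, r3, r4); ring.
  move=> i j k m; rewrite !riemann_delta /curv_lower -big_split big1 // => l _ /=.
  by rewrite (curv_coef_skew12 i j); ring.
- move=> u v w z; apply/eqP; rewrite -addr_eq0; apply/eqP.
  apply: (multilinear4_eq0 (F := fun u v w z => riemann G x u v w z
    + riemann G x u v z w)).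
    by split=> y1 y2 y3 a s t; rewrite (r1, r2, r3, r4) (r1, r2, r3, r4); ring.
  by move=> i j k m; rewrite !riemann_delta (curv_lower_skew34 i j k) // addNr.
- apply: (multilinear4_eq0 (F := fun u v w z => riemann G x u v w z
    + riemann G x v w u z + riemann G x w u v z)).
    by split=> y1 y2 y3 a s t; rewrite !(r1, r2, r3, r4); ring.
  move=> i j k m; rewrite !riemann_delta /curv_lower -!big_split big1 // => l _ /=.
  by rewrite -!mulrDl curv_coef_bianchi // mul0r.
Qed.

End RiemannSymmetries.

(** * From one point in a chart to the manifold *)

Lemma curvature_like_geom_at (R : realType) (n : nat) (M : manifold R n)
    (g : metric M) (c : chart R n M) (p : M) :
  atlas M c -> cdom c p -> curvature_like (geom_at g c p).
Proof.
move=> cM cp; apply: (@riemann_curvature_like _ _ (gmat g c) (cim c)).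
- exact: cim_open.
- exact: gmat_smooth.
- exact: gmat_sym.
- exact: gmat_nondeg.
- by exists p.
Qed.

Theorem theorem4p11 (R : realType) (n : nat) (n_ge3 : (3 <= n)%N)
    (M : manifold R n) (M_connected : connected [set: M])
    (g : metric M) (L : M -> R) (L_smooth : smooth_fun L)
    (PP : holds g (fun p a =>
       dot (gm a) (PT a) (PT a) = L p *: tachibana (ST a) (PT a))) :
  let U := [set p : M | L p != - (n%:R - 1)^-1] in
  (holds g (fun p a =>
     dot (gm a) (PT a) (RT a) = L p *: tachibana (ST a) (RT a))
   <->
   holds g (fun p a =>
     dot (gm a) (RT a) (wedgeST a)
     = (L p + (n%:R - 1)^-1) *: tachibana (ST a) (wedgeST a)))
  /\
  (holds g (fun p a =>
     dot (gm a) (RT a) (RT a) = L p *: tachibana (ST a) (RT a))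
   <->
   holds g (fun p a =>
     dot (gm a) (RT a) (wedgeST a) + tachibana (ST a) (RT a)
     = (L p + (n%:R - 1)^-1) *: tachibana (ST a) (wedgeST a)))
  /\
  (holds g (fun p a =>
     dot (gm a) (RT a) (PT a) = L p *: tachibana (ST a) (PT a))
   <->
   holds g (fun _ a => tachibana (ST a) (PT a) = 0))
  /\
  holds g (fun p a =>
    (n%:R * (n%:R - 1)) *: dot (gm a) (RT a) (ST a)
    = (scal a * (1 + (n%:R - 1) * L p)) *: tachibana (gT a) (ST a))
  /\
  holds_on g U (fun _ a => (n%:R - 1) *: ET a = scal a *: ST a - S2T a)
  /\
  (holds_on g U (fun _ a =>
     n%:R ^+ 2 *: S2T a - (2 * n%:R * scal a) *: ST a
       + scal a ^+ 2 *: gT a = 0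
     /\ scal2 a = scal a ^+ 2 / n%:R)
   /\ (riemannian g -> einstein_on g U))
  /\
  holds_on g U (fun p a =>
    (L p * scal a) *: (n%:R *: ST a - scal a *: gT a) = 0).
Proof.
move=> U.
have cl c p : atlas M c -> cdom c p -> curvature_like (geom_at g c p).
  exact: curvature_like_geom_at.
(* Each clause is checked at one chart and one point; membership in [U] supplies the condition on L
   for (v) to (vii). *)
split; [|split; [|split; [|split; [|split; [|split; [split|]]]]]].
- by split=> H c p cM cp pM;
    have [h h'] := PT_RT_iff (cl c p cM cp) n_ge3 (PP c p cM cp pM);
    [exact: h (H c p cM cp pM)|exact: h' (H c p cM cp pM)].
- by split=> H c p cM cp pM;
    have [h h'] := RT_RT_iff (cl c p cM cp) n_ge3 (PP c p cM cp pM);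
    [exact: h (H c p cM cp pM)|exact: h' (H c p cM cp pM)].
- by split=> H c p cM cp pM;
    have [h h'] := RT_PT_iff (cl c p cM cp) n_ge3 (PP c p cM cp pM);
    [exact: h (H c p cM cp pM)|exact: h' (H c p cM cp pM)].
- move=> c p cM cp pM.
  exact: curv_ric_tensor (cl c p cM cp) n_ge3 _ (PP c p cM cp pM).
- move=> c p cM cp Up.
  exact: ET_tensor (cl c p cM cp) n_ge3 _ (PP c p cM cp I) Up.
- move=> c p cM cp Up; split.
    exact: S2T_tensor (cl c p cM cp) n_ge3 _ (PP c p cM cp I) Up.
  exact: scal2_div (cl c p cM cp) n_ge3 _ (PP c p cM cp I) Up.
- move=> gpos c p cM cp Up.
  apply: (einstein_of_definite (cl c p cM cp) n_ge3 (PP c p cM cp I) Up).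
  by apply: gpos cM _ _; exists p.
- move=> c p cM cp Up.
  exact: einstein_defect (cl c p cM cp) n_ge3 _ (PP c p cM cp I) Up.
Qed.
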